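(* Let $m^*=m^*_\beta\ge1$ and $k^*=k^*_\beta>m^*_\beta$ be integer-valued functions of $\beta\in(0,1)$. Put $$\varrho_{1,\beta}=\frac1{1+|\log\beta|},\quad \varrho_{2,\beta}=\frac{\varrho_{1,\beta}}{1+|\log|\log\beta||},\quad \alpha_{1,\beta}=\beta+(1-\varrho_{1,\beta})^{m^*_\beta+1},\quad \alpha_{2,\beta}=\beta(1-\varrho_{2,\beta})^{k^*_\beta},$$ and assume that $$\lim_{\beta\to0}\frac{|\log\alpha_{1,\beta}|}{|\log\beta|}=1\quad\text{and}\quad\lim_{\beta\to0}\frac{|\log\alpha_{2,\beta}|}{|\log\beta|}=1.$$ Let $T_\beta=\inf\{n\ge1:\sum_{k=1}^ne^{Z^{k-1}_n}\ge h_\beta\}$ with $h_\beta=\frac{1-\alpha_{2,\beta}}{\varrho_{2,\beta}\,\alpha_{2,\beta}}$. Then, for any $0<\beta<1$, $T_\beta\in\mathcal H(\beta,k^*,m^* )$. If, in addition, for some $0<I<\infty$ $$\sum_{n=1}^\infty\sup_{k\ge0}\mathsf P_k\Big\{\Big|\frac1nZ^k_{k+n}-I\Big|>\varepsilon\Big\}<\infty\quad\text{for all }\varepsilon>0,$$ then $$\lim_{\beta\to0}\frac{\inf_{\tau\in\mathcal H(\beta,k^*,m^* )}\mathcal R_\nu(\tau)}{\mathcal R_\nu(T_\beta)}=1\ \text{ for all }\nu\ge0,\qquad\lim_{\beta\to0}\frac{\inf_{\tau\in\mathcal H(\beta,k^*,m^* )}\sup_{\nu\ge0}\mathcal R_\nu(\tau)}{\sup_{\nu\ge0}\mathcal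 R_\nu(T_\beta)}=1,$$ and, as $\beta\to0$, $$\mathcal R_\nu(T_\beta)\sim\inf_{\tau\in\mathcal H(\beta,k^*,m^* )}\mathcal R_\nu(\tau)\sim\frac{|\log\beta|}I\ \text{ for any }\nu\ge0,\qquad \sup_{\nu\ge0}\mathcal R_\nu(T_\beta)\sim\inf_{\tau\in\mathcal H(\beta,k^*,m^* )}\sup_{\nu\ge0}\mathcal R_\nu(\tau)\sim\frac{|\log\beta|}I.$$
   Context: Model. $X_1,X_2,\dots$ are observed random variables, $\mathbf X^n=(X_1,\dots,X_n)$, $\mathcal F_n=\sigma(X_1,\dots,X_n)$. The change point is $\nu\in\{0,1,2,\dots\}\cup\{\infty\}$; $X_\nu$ is the last pre-change observation and $\nu=\infty$ means no change. $f_{0,n}(X_n|\mathbf X^{n-1})$ and $f_{1,n}(X_n|\mathbf X^{n-1})$, $n\ge1$, are the pre- and post-change conditional densities of $X_n$ given $\mathbf X^{n-1}$ with respect to a sigma-finite measure $\mu$ (for $n=1$, unconditional densities; $f_{1,n}$ may depend on the change point). Under $\mathsf P_\infty$ (expectation $\mathsf E_\infty$) the conditional density of $X_n$ given $\mathbf X^{n-1}$ is $f_{0,n}$ for all $n\ge1$; under $\mathsf P_k$ (expectation $\mathsf E_k$), $0\le k<\infty$, it is $f_{0,n}$ for $n\le k$ and $f_{1,n}$ for $n>k$. For $k\le n-1$ the log-likelihood ratio is $$Z^k_n=\sum_{j=k+1}^n\log\frac{f_{1,j}(X_j|\mathbf X^{j-1})}{f_{0,j}(X_j|\mathbf X^{j-1})},\qquad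 \frac{d\mathsf P_k|_{\mathcal F_n}}{d\mathsf P_\infty|_{\mathcal F_n}}=e^{Z^k_n}$$ (where $f_{1,j}$ is the post-change density corresponding to change point $k$). $\mathcal M$ is the set of stopping times $\tau$ with respect to $(\mathcal F_n)$ with values in $\{1,2,\dots\}\cup\{\infty\}$; $\inf\varnothing=+\infty$. Risk, for finite $\nu\ge0$: $\mathcal R_\nu(\tau)=\mathsf E_\nu(\tau-\nu)^+$. For $0<\beta<1$ and integers $m^*\ge1$, $k^*>m^*$, $$\mathcal H(\beta,k^*,m^* )=\Big\{\tau\in\mathcal M:\sup_{1\le k\le k^*-m^*}\mathsf P_\infty(k\le\tau<k+m^* )\le\beta\Big\}.$$ $a_\beta\sim b_\beta$ means $a_\beta/b_\beta\to1$. *)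

(* Defs.v *)
From HB Require Import structures.
From mathcomp Require Import all_boot all_order all_algebra.
From mathcomp Require Import all_classical all_reals all_analysis.
Import Order.TTheory GRing.Theory Num.Theory.
Import numFieldNormedType.Exports.

Set Implicit Arguments.
Unset Strict Implicit.
Unset Printing Implicit Defensive.

Local Open Scope classical_set_scope.
Local Open Scope ring_scope.

(* The extended index set {0, 1, 2, ...} U {oo} is [option nat], [None] being
   oo; it is used for the change point and for the values of stopping times.
   Observations are numbered from 0: [X j] is the (j+1)-st observation, so
   (X_1, ..., X_n) is (X 0, ..., X (n - 1)), and a change at k means that
   [X j] is pre-change if j < k and post-change if k <= j. *)

Section model.
Context {R : realType} {dO dE : measure_display}.
Context {Omega : measurableType dO} {E : measurableType dE}.
Variables (mu : {sigma_finite_measure set E -> \bar R}).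
Variable P : option nat -> probability Omega R.
Variable X : nat -> {mfun Omega >-> E}.
(* [f0 j h x]: pre-change density of [X j] at [x] given that the first [j]
   observations are [h]; [f1 k j h x]: the post-change one for a change at [k]
   (only its values for k <= j matter). *)
Variable f0 : forall j, j.-tuple E -> E -> R.
Variable f1 : nat -> forall j, j.-tuple E -> E -> R.

Definition history (n : nat) (w : Omega) : n.-tuple E := [tuple X i w | i < n].

Definition sigma_history (n : nat) : set (set Omega) :=
  g_sigma_preimage (fun i : 'I_n => X i : Omega -> E).

Definition density (nu : option nat) (j : nat) : j.-tuple E -> E -> R :=
  if nu is Some k then (if (j < k)%N then f0 (j := j) else f1 k (j := j))
  else f0 (j := j).

Definition is_conditional_density (Q : probability Omega R) (j : nat)
    (f : j.-tuple E -> E -> R) : Prop :=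
  [/\ measurable_fun [set: j.-tuple E * E] (fun hx => f hx.1 hx.2),
      (forall h x, 0 <= f h x),
      (forall h, \int[mu]_x (f h x)%:E = 1)%E &
      forall (B : set (j.-tuple E)) (C : set E), measurable B -> measurable C ->
        (Q (history j @^-1` B `&` X j @^-1` C) =
         \int[Q]_(w in history j @^-1` B)
           \int[mu]_(x in C) (f (history j w) x)%:E)%E].

(* Z^k_n = log (prod_{k <= j < n} f1/f0), with log 0 = -oo, so it takes values
   in [-oo, +oo).  The division is the one of [R], for which x / 0 = 0; it only
   matters where a pre-change density vanishes, a [P None]-null event. *)
Definition llr (k n : nat) (w : Omega) : \bar R :=
  (\sum_(k <= j < n)
     lne (f1 k (history j w) (X j w) / f0 (history j w) (X j w))%:E)%E.

Record change_point_model : Prop := {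
  model_density : forall (nu : option nat) (j : nat),
    is_conditional_density (P nu) (density nu (j := j));
  (* exp Z^k_n is the Radon-Nikodym derivative of [P (Some k)] with respect to
     [P None] on the sigma-algebra of the first [n] observations *)
  model_likelihood_ratio : forall (k n : nat) (A : set Omega),
    (k < n)%N -> sigma_history n A ->
    (P (Some k) A = \int[P None]_(w in A) expeR (llr k n w))%E }.

Definition stopping_time (tau : Omega -> option nat) : Prop :=
  (forall w, tau w <> Some 0%N) /\
  (forall n, sigma_history n
     [set w | exists2 t, tau w = Some t & (t <= n)%N]).

(* (tau - nu)^+, by truncated subtraction *)
Definition delay (nu : nat) (t : option nat) : \bar R :=
  if t is Some n then ((n - nu)%N%:R)%:E else +oo%E.

Definition risk (nu : nat) (tau : Omega -> option nat) : \bar R :=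
  (\int[P (Some nu)]_w delay nu (tau w))%E.

Definition sup_risk (tau : Omega -> option nat) : \bar R :=
  ereal_sup (range (fun nu => risk nu tau)).

Definition false_alarm_class (beta : R) (kstar mstar : nat) :
    set (Omega -> option nat) :=
  [set tau | stopping_time tau /\
    (ereal_sup [set P None [set w | exists2 t, tau w = Some t
                                   & (k <= t < k + mstar)%N]
               | k in [set k | (1 <= k <= kstar - mstar)%N]] <= beta%:E)%E].

Definition first_time (Q : pred nat) : option nat :=
  if pselect (exists n, Q n) is left exQ then Some (ex_minn exQ) else None.

Definition sr_time (h : R) (w : Omega) : option nat :=
  first_time (fun n => (1 <= n)%N &&
    (h%:E <= \sum_(0 <= k < n) expeR (llr k n w))%E).

Definition uniform_complete_convergence (I : R) : Prop :=
  forall eps : R, 0 < eps ->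
    (\sum_(1 <= n <oo) ereal_sup (range (fun k =>
        P (Some k) [set w | eps%:E <
          `| (n%:R^-1)%:E * llr k (k + n) w - I%:E |])) < +oo)%E.

End model.

Section thresholds.
Context {R : realType}.
Variables mstar kstar : R -> nat.

Definition rho1 (beta : R) : R := (1 + `|ln beta|)^-1.
Definition rho2 (beta : R) : R := rho1 beta / (1 + `|ln `|ln beta| |).
Definition alpha1 (beta : R) : R :=
  beta + (1 - rho1 beta) ^+ (mstar beta).+1.
Definition alpha2 (beta : R) : R := beta * (1 - rho2 beta) ^+ kstar beta.
Definition threshold (beta : R) : R :=
  (1 - alpha2 beta) / (rho2 beta * alpha2 beta).

End thresholds.

(* In [\bar R], x / +oo = 0 and x / 0 is 0 or infinite, so a ratio tending to 1
   has finite nonzero terms eventually. *)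
Definition asymp_equiv {R : realType} (u v : R -> \bar R) : Prop :=
  (u beta / v beta)%E @[beta --> 0^'+] --> 1%E.

(* Main.v *)
Require Import Defs.
From HB Require Import structures.
From mathcomp Require Import all_boot all_order all_algebra.
From mathcomp Require Import all_classical all_reals all_analysis.
From mathcomp Require Import measurable_realfun zify ring lra.
Import Order.TTheory GRing.Theory Num.Theory.
Import numFieldNormedType.Exports.
Local Open Scope classical_set_scope.
Local Open Scope ring_scope.

(** Write [x = `|ln beta|] and [l = x / I].  Near [beta = 0],
    the risks of the Shiryaev-Roberts rule and the infima over the class all
    lie between [(1 - eps) * l] and [(1 + eps) * l], for every [eps > 0]; the
    limits then follow by division ([squeezed_asymp_equiv]).

    The Shiryaev-Roberts rule belongs to the class ([sr_false_alarm_class]).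
    On the event that it stops at time [m], the statistic
    [\sum_(k < m) exp Z^k_m] is at least [h], and the integral of this
    statistic under [P None] over the event is the sum over [k < m] of the
    probabilities [P (Some k)] of the event.  Summing over [m <= n] gives
    [h * P_oo (T <= n) <= \sum_(k < n) P_k (T <= n) <= n].  Every window of the
    class lies before [kstar], so it remains to see that
    [kstar - 1 <= beta * h]; this is the inequality
    [(1 - rho) ^ k * (1 + k * rho) <= 1].

    Upper bound ([near_sr_risk_le]).  The statistic dominates [exp Z^nu_n], so
    as long as the rule has not stopped [n] observations after the change,
    [Z^nu_(nu + n) < ln h].  For [n] beyond [ln h / (I - d)] this puts
    [Z^nu_(nu + n) / n] at distance more than [d] from [I], an event whose
    probabilities have a sum that is bounded uniformly in [nu].  Hence the risk
    is at most [ln h / (I - d) + O(1)], and [ln h] is equivalent to [x]: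
    by hypothesis [- ln alpha2] is, and [rho2] is only polynomially small in
    [x].

    Lower bound ([near_class_risk_ge]).  Let [n] be about [(1 - d) * l].  Since
    [ln alpha1] is equivalent to [ln beta], the window length [mstar] grows at
    least like [x ^ 2], so the first window contains all the times from 1 to
    [nu + n], and a rule of the class stops by [nu + n] with probability at most
    [beta] under [P None].  Changing the measure at the fixed time [nu + n]
    costs a factor [exp ((1 + d) * I * n)], which is at most
    [exp ((1 - d ^ 2) * x)] and so negligible against [1 / beta = exp x], up to
    the event that the log-likelihood ratio exceeds [(1 + d) * I * n], which is
    unlikely.  So under [P (Some nu)] the rule has probability close to 1 of not
    having stopped by [nu + n], and its risk is at least about [n]. *)

Set Implicit Arguments.
Unset Strict Implicit.
Unset Printing Implicit Defensive.

(** * The threshold and the window length as beta tends to 0 *)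

Section thresholds.
Context {R : realType}.
Context (mstar kstar : R -> nat).
Implicit Types beta rho eps : R.

(** Bernoulli's inequality for [(1 + rho) ^+ k], multiplied by
    [(1 - rho) ^+ k]. *)
Lemma exprB_mul_le1 rho k : 0 <= rho <= 1 ->
  (1 - rho) ^+ k * (1 + k%:R * rho) <= 1.
Proof.
move=> /andP[rho0 rho1]; elim: k => [|k IHk]; first by rewrite expr0; lra.
apply: le_trans IHk; rewrite exprSr -mulrA ler_wpM2l ?exprn_ge0 ?subr_ge0 //.
rewrite -natr1; have k0 : 0 <= k%:R :> R by [].
by nra.
Qed.

Lemma lnN_gt0 beta : 0 < beta < 1 -> 0 < - ln beta.
Proof. by move=> /andP[b0 b1]; rewrite oppr_gt0 ln_lt0 // b0 b1. Qed.

Lemma norm_ln beta : 0 < beta < 1 -> `|ln beta| = - ln beta.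
Proof. by move=> /lnN_gt0; rewrite oppr_gt0 => /ltr0_norm. Qed.

Lemma norm_ln_gt0 beta : 0 < beta < 1 -> 0 < `|ln beta|.
Proof. by move=> b01; rewrite norm_ln ?lnN_gt0. Qed.

Lemma oneD_norm_gt0 (x : R) : 0 < 1 + `|x|.
Proof. by rewrite ltr_wpDr. Qed.

Lemma rho2_itv beta : 0 < beta < 1 -> 0 < rho2 beta < 1.
Proof.
move=> /norm_ln_gt0 x0; rewrite /rho2 /rho1; apply/andP; split.
  by rewrite divr_gt0 ?invr_gt0 ?oneD_norm_gt0.
rewrite ltr_pdivrMr ?oneD_norm_gt0 // mul1r.
apply: (@lt_le_trans _ _ 1); last by rewrite lerDl.
by rewrite invf_lt1 ?oneD_norm_gt0 // ltrDl.
Qed.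

Lemma alpha2_itv beta : 0 < beta < 1 -> 0 < alpha2 kstar beta <= beta.
Proof.
move=> b01; have /andP[r0 r1] := rho2_itv b01; have /andP[b0 b1] := b01.
rewrite /alpha2; apply/andP; split.
  by rewrite mulr_gt0 // exprn_gt0 // subr_gt0.
by rewrite ler_piMr ?(ltW b0) //; apply: exprn_ile1; lra.
Qed.

Lemma threshold_gt0 beta : 0 < beta < 1 -> 0 < threshold kstar beta.
Proof.
move=> b01; have /andP[r0 _] := rho2_itv b01; have /andP[_ b1] := b01.
have /andP[a0 ab] := alpha2_itv b01.
apply: divr_gt0; first by rewrite subr_gt0 (le_lt_trans ab).
exact: mulr_gt0.
Qed.

(** The reason for the form of the threshold: with [q = (1 - rho2) ^+ kstar],
    [beta * threshold] is [(1 - beta * q) / (rho2 * q)], and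
    [q * (1 + kstar * rho2) <= 1]. *)
Lemma threshold_false_alarm beta : 0 < beta < 1 -> (0 < kstar beta)%N ->
  (kstar beta).-1%:R <= beta * threshold kstar beta.
Proof.
move=> b01; have /andP[r0 r1] := rho2_itv b01; have /andP[b0 b1] := b01.
rewrite /threshold /alpha2; set rho := rho2 beta in r0 r1 *.
case: (kstar beta) => [//|k] _ /=; set q := (1 - rho) ^+ k.+1.
have q0 : 0 < q by rewrite exprn_gt0 // subr_gt0.
have -> : beta * ((1 - beta * q) / (rho * (beta * q))) =
    (1 - beta * q) / (rho * q).
  by field; rewrite !gt_eqF.
have bq : beta * q <= q by rewrite ler_piMl ?ltW.
have rq : 0 < rho * q by exact: mulr_gt0.
rewrite ler_pdivlMr //.
have : q * (1 + k.+1%:R * rho) <= 1 by apply: exprB_mul_le1; lra.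
by rewrite -natr1; lra.
Qed.

Lemma near_lt1 : \forall beta \near (0 : R)^'+, 0 < beta < 1.
Proof.
near=> beta; apply/andP; split; first by near: beta; exact: nbhs_right_gt.
by near: beta; exact: nbhs_right_lt.
Unshelve. all: by end_near. Qed.

Lemma near_norm_ln_ge (A : R) : \forall beta \near (0 : R)^'+, A <= `|ln beta|.
Proof.
have /cvgrNyPle/(_ (- A)) lnA := @lnNy R.
near=> beta; rewrite -[A]opprK; apply: (@le_trans _ _ (- ln beta)).
  by rewrite lerN2; near: beta.
by rewrite -normrN ler_norm.
Unshelve. all: by end_near. Qed.

(** The logarithm is [o(x)], with an explicit constant: apply [ln y < y] at
    [y = delta * (1 + x)]. *)
Lemma ln1D_le (delta x : R) : 0 < delta -> 0 <= x ->
  ln (1 + x) <= delta * x + (delta - ln delta).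
Proof.
move=> d0 x0; have x1 : 0 < 1 + x by rewrite ltr_wpDr.
have : ln (delta * (1 + x)) < delta * (1 + x).
  by apply: ln_sublinear; rewrite mulr_gt0.
by rewrite lnM ?posrE // mulrDr mulr1; lra.
Qed.

(** Of the factors of the threshold, [1 - alpha2] is at most 1 and [rho2]
    contributes [ln (1 + x) + ln (1 + ln x)], which is at most twice
    [ln (1 + x)]. *)
Lemma ln_threshold_le beta : 0 < beta < 1 -> 1 <= `|ln beta| ->
  ln (threshold kstar beta) <=
    2 * ln (1 + `|ln beta|) + `|ln (alpha2 kstar beta)|.
Proof.
move=> b01 x1; have /andP[r0 _] := rho2_itv b01; have /andP[_ b1] := b01.
have /andP[a0 ab] := alpha2_itv b01; set x := `|ln beta| in x1 *.
have x0 : 0 < x by exact: lt_le_trans x1.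
have lnx0 : 0 <= ln x by exact: ln_ge0.
have a1 : 0 < 1 - alpha2 kstar beta by rewrite subr_gt0 (le_lt_trans ab).
have ra0 : 0 < rho2 beta * alpha2 kstar beta by exact: mulr_gt0.
have lnx1 : 0 < 1 + ln x by lra.
have x10 : 0 < 1 + x by lra.
rewrite /threshold ln_div ?posrE // lnM ?posrE //.
have -> : ln (rho2 beta) = - ln (1 + x) - ln (1 + ln x).
  rewrite /rho2 /rho1 -/x (ger0_norm lnx0).
  by rewrite ln_div ?lnV ?posrE ?invr_gt0.
have : ln (1 - alpha2 kstar beta) <= 0 by apply: ln_le0; lra.
have : ln (1 + ln x) <= ln (1 + x).
  by rewrite ler_ln ?posrE // lerD2l ltW // ln_sublinear.
have : - ln (alpha2 kstar beta) <= `|ln (alpha2 kstar beta)|.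
  by rewrite -normrN ler_norm.
by lra.
Qed.

Lemma near_ln_threshold_le
  (lim_alpha2 :
     `|ln (alpha2 kstar beta)| / `|ln beta| @[beta --> 0^'+] --> (1 : R)) eps :
  0 < eps ->
  \forall beta \near 0^'+, ln (threshold kstar beta) <= (1 + eps) * `|ln beta|.
Proof.
move=> eps0; have eps2 : 0 < eps / 2 by rewrite divr_gt0.
have /cvgrPdist_le/(_ _ eps2) lim2 := lim_alpha2.
pose d := eps / 8; have d0 : 0 < d by rewrite divr_gt0.
near=> beta.
have b01 : 0 < beta < 1 by near: beta; exact: near_lt1.
have x1 : 1 <= `|ln beta| by near: beta; exact: near_norm_ln_ge.
have xA : 2 * (d - ln d) / (eps / 4) <= `|ln beta|.
  by near: beta; exact: near_norm_ln_ge.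
have a2 : `|1 - `|ln (alpha2 kstar beta)| / `|ln beta| | <= eps / 2.
  by near: beta.
have x0 := norm_ln_gt0 b01.
have {}a2 : `|ln (alpha2 kstar beta)| <= (1 + eps / 2) * `|ln beta|.
  rewrite -ler_pdivrMr //; move: a2; rewrite ler_norml; lra.
rewrite ler_pdivrMr ?divr_gt0 // in xA.
have := ln_threshold_le b01 x1; have := ln1D_le d0 (ltW x0).
have dx : d * `|ln beta| = eps * `|ln beta| / 8 by rewrite /d; field.
by move: xA a2; rewrite dx; lra.
Unshelve. all: by end_near. Qed.

(** With [q = 1 - rho1], the hypothesis gives
    [q ^+ mstar.+1 <= alpha1 <= expR (- x / 2)], while
    [- ln q = ln (1 + x^-1) <= x^-1].  Hence [mstar.+1 >= x ^+ 2 / 2], which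
    exceeds any given multiple of [x] once [x] is large. *)
Lemma near_mstar_ge
  (lim_alpha1 :
     `|ln (alpha1 mstar beta)| / `|ln beta| @[beta --> 0^'+] --> (1 : R))
  (A : R) :
  \forall beta \near 0^'+, A * `|ln beta| <= (mstar beta)%:R.
Proof.
have h0 : 0 < 2^-1 :> R by [].
have /cvgrPdist_le/(_ _ h0) lim1 := lim_alpha1.
near=> beta.
have b01 : 0 < beta < 1 by near: beta; exact: near_lt1.
have x3 : 3 <= `|ln beta| by near: beta; exact: near_norm_ln_ge.
have xA : 2 * (A + 1) <= `|ln beta| by near: beta; exact: near_norm_ln_ge.
have a1 : `|1 - `|ln (alpha1 mstar beta)| / `|ln beta| | <= 2^-1 by near: beta.
have x0 := norm_ln_gt0 b01; have /andP[b0 b1] := b01.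
have {}a1 : `|ln beta| / 2 <= `|ln (alpha1 mstar beta)|.
  have : 2^-1 <= `|ln (alpha1 mstar beta)| / `|ln beta|.
    by move: a1; rewrite ler_norml; lra.
  by rewrite ler_pdivlMr // mulrC.
move: a1; rewrite /alpha1 /rho1; set x := `|ln beta| in x3 xA x0 *.
set m := mstar beta; set q := 1 - _ => a1.
have qE : q = (1 + x^-1)^-1.
  by rewrite /q; field; rewrite !gt_eqF // ltr_wpDr // ltW.
have q0 : 0 < q by rewrite qE invr_gt0 addr_gt0 // invr_gt0.
have q1 : q <= 1.
  by rewrite qE invf_le1 ?lerDl ?invr_ge0 ?(ltW x0) // addr_gt0 ?invr_gt0.
have qm0 : 0 < q ^+ m.+1 by rewrite exprn_gt0.
have qm1 : q ^+ m.+1 <= 1 by rewrite exprn_ile1 // ltW.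
have a0 : 0 < beta + q ^+ m.+1 by rewrite addr_gt0.
(* A positive logarithm of alpha1 would be at least x / 2 > 1, which is
   impossible since alpha1 <= 2. *)
have small : ln (beta + q ^+ m.+1) <= - (x / 2).
  move: a1; case: (ger0P (ln (beta + q ^+ m.+1))) => [ln0|_]; last by lra.
  have : ln (beta + q ^+ m.+1) <= 1.
    move: (q ^+ m.+1) qm1 a0 => r r1 br0.
    have : ln (1 + (beta + r - 1)) <= beta + r - 1 by apply: le_ln1Dx; lra.
    by rewrite [1 + _]addrC subrK; lra.
  by lra.
have : ln (q ^+ m.+1) <= - (x / 2).
  by apply: le_trans small; rewrite ler_ln ?posrE // lerDr ltW.
rewrite lnXn // qE lnV ?posrE ?addr_gt0 ?invr_gt0 // mulNrn lerN2.
rewrite -[X in _ <= X]mulr_natl => mln.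
have : x / 2 <= m.+1%:R * x^-1.
  apply: le_trans mln _; rewrite ler_wpM2l // le_ln1Dx //.
  by apply: (@lt_trans _ _ 0) => //; rewrite invr_gt0.
rewrite ler_pdivlMr // -[m.+1%:R]natr1 => mx.
have : 2 * (A + 1) * x <= x * x by rewrite ler_pM2r.
by lra.
Unshelve. all: by end_near. Qed.

End thresholds.

(** * First-order equivalence of extended real functions *)

Section first_order.
Context {R : realType}.
Implicit Types (a b : R -> \bar R) (l : R -> R).

(** First-order equality of [a] and [l] as [beta] tends to 0, stated by bounds
    because [a] may be infinite away from 0. *)
Definition squeezed a l := forall eps : R, 0 < eps ->
  \forall beta \near 0^'+,
    (((1 - eps) * l beta)%:E <= a beta <= ((1 + eps) * l beta)%:E)%E.

Lemma squeezed_refl l : (\forall beta \near 0^'+, 0 < l beta) ->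
  squeezed (fun beta => (l beta)%:E) l.
Proof.
move=> l0 eps eps0; near=> beta.
have lb : 0 < l beta by near: beta.
by rewrite !lee_fin; apply/andP; split; nra.
Unshelve. all: by end_near. Qed.

Lemma squeezed_asymp_equiv a b l : (\forall beta \near 0^'+, 0 < l beta) ->
  squeezed a l -> squeezed b l -> asymp_equiv a b.
Proof.
move=> l0 al bl.
have close e : 0 < e -> \forall beta \near 0^'+,
    exists2 r, (a beta / b beta)%E = r%:E & `|1 - r| <= e.
  (* If x and y are within eps * l of l and eps <= 1/2, then y >= l / 2 and
     |1 - x / y| <= 4 * eps. *)
  move=> e0; pose eps := Num.min 2^-1 (e / 4).
  have eps0 : 0 < eps by rewrite lt_min; apply/andP; split; lra.
  near=> beta.
  have lb : 0 < l beta by near: beta.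
  have : (((1 - eps) * l beta)%:E <= a beta <= ((1 + eps) * l beta)%:E)%E.
    by near: beta; exact: al.
  have : (((1 - eps) * l beta)%:E <= b beta <= ((1 + eps) * l beta)%:E)%E.
    by near: beta; exact: bl.
  have epsh : eps <= 2^-1 by rewrite /eps ge_min lexx.
  have epse : eps <= e / 4 by rewrite /eps ge_min lexx orbT.
  case: (b beta) => [y||] // /andP[]; rewrite ?leye_eq // !lee_fin => y1 y2.
  case: (a beta) => [x||] // /andP[]; rewrite ?leye_eq // !lee_fin => x1 x2.
  have yl : l beta / 2 <= y by apply: le_trans y1; nra.
  have y0 : 0 < y by lra.
  exists (x / y); first by rewrite /inve gt_eqF.
  have -> : 1 - x / y = (y - x) / y by field; rewrite gt_eqF.
  rewrite normrM normfV (gtr0_norm y0) ler_pdivrMr // ler_norml.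
  have le : eps * l beta <= e / 4 * l beta by rewrite ler_pM2r.
  have ye : e * (l beta / 2) <= e * y by rewrite ler_pM2l.
  by apply/andP; split; lra.
apply/fine_cvgP; split.
  have := close _ (@ltr01 R); apply: filterS => beta [r -> _] //.
apply/cvgrPdist_le => e e0; have := close e e0.
by apply: filterS => beta [r /= -> ].
Unshelve. all: by end_near. Qed.

End first_order.

(** * Measurability of the likelihood ratios with respect to the past *)

Section change_point.
Context {R : realType} {dO dE : measure_display}.
Context {Omega : measurableType dO} {E : measurableType dE}.
Context (mu : {sigma_finite_measure set E -> \bar R}).
Context (P : option nat -> probability Omega R).
Context (X : nat -> {mfun Omega >-> E}).
Context (f0 : forall j, j.-tuple E -> E -> R).
Context (f1 : nat -> forall j, j.-tuple E -> E -> R).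
Context (model : change_point_model mu P X f0 f1).

Local Notation Z := (llr X f0 f1).

(** [Omega] with the sigma-algebra of the first [n] observations: events and
    functions determined by the past are the measurable ones for this type, so
    the closure properties of measurable sets and functions apply to them. *)
Definition past (n : nat) := g_sigma_algebra_preimageType (history X n).

Lemma sigma_historyE n :
  sigma_history X n = (measurable : set (set (past n))).
Proof.
rewrite /sigma_history.
have -> : (fun i : 'I_n => X i : Omega -> E) =
          (fun i => (@tnth n E ^~ i) \o history X n).
  by apply/funext => i; apply/funext => w /=; rewrite tnth_mktuple.
by rewrite g_sigma_preimage_comp.
Qed.

Lemma past_measurable_obs n j : (j < n)%N ->
  measurable_fun (setT : set (past n)) (X j : Omega -> E).
Proof.
move=> jn.
have -> : (X j : Omega -> E) = (@tnth n E ^~ (Ordinal jn)) \o history X n.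
  by apply/funext => w /=; rewrite tnth_mktuple.
apply: measurableT_comp; first exact: measurable_tnth.
by move=> _ B mB; exists B.
Qed.

Lemma past_measurable_history n j : (j <= n)%N ->
  measurable_fun (setT : set (past n)) (history X j : Omega -> j.-tuple E).
Proof.
move=> jn; apply/measurable_fun_tnthP => i.
rewrite (_ : _ \o _ = (X i : Omega -> E)); last first.
  by apply/funext => w /=; rewrite tnth_mktuple.
by apply: past_measurable_obs; exact: leq_trans jn.
Qed.

Lemma sigma_history_measurable n (A : set Omega) :
  sigma_history X n A -> measurable A.
Proof.
rewrite sigma_historyE => -[B mB <-].
have mX : measurable_fun setT (history X n : Omega -> n.-tuple E).
  apply/measurable_fun_tnthP => i.
  rewrite (_ : _ \o _ = (X i : Omega -> E)) ; last first.
    by apply/funext => w /=; rewrite tnth_mktuple.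
  by [].
exact: mX.
Qed.


Lemma sigma_history_le m n (A : set Omega) : (m <= n)%N ->
  sigma_history X m A -> sigma_history X n A.
Proof.
move=> mn; rewrite !sigma_historyE => -[B mB <-].
exact: (past_measurable_history mn measurableT mB).
Qed.

Lemma likelihood_ratio_ge0 k j w : (k <= j)%N ->
  0 <= f1 k (history X j w) (X j w) / f0 (history X j w) (X j w).
Proof.
move=> kj; have [_ f0ge0 _ _] := model_density model None j.
have [_ f1ge0 _ _] := model_density model (Some k) j.
by move: f1ge0; rewrite /density ltnNge kj /= => f1ge0; exact: divr_ge0.
Qed.

Lemma past_measurable_likelihood_ratio n k j : (k <= j < n)%N ->
  measurable_fun (setT : set (past n))
    (fun w => f1 k (history X j w) (X j w) / f0 (history X j w) (X j w)).
Proof.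
move=> /andP[kj jn].
have mHX : measurable_fun (setT : set (past n))
    (fun w : Omega => (history X j w, X j w)).
  apply: measurable_fun_pair; last exact: past_measurable_obs.
  exact: past_measurable_history (ltnW jn).
have [mf0 _ _ _] := model_density model None j.
have [mf1 _ _ _] := model_density model (Some k) j.
move: mf1; rewrite /density ltnNge kj /= => mf1.
apply: measurable_funM; first exact: measurableT_comp mf1 mHX.
have [_ f0ge0 _ _] := model_density model None j.
under eq_fun do rewrite -powR_inv1 ?f0ge0 //.
have := measurableT_comp (measurable_powR (- 1)) (measurableT_comp mf0 mHX).
exact.
Qed.

Lemma measurable_lne_EFin d (T : measurableType d) (g : T -> R) :
  measurable_fun setT g -> measurable_fun setT (fun x => lne (g x)%:E).
Proof.
move=> mg; rewrite /lne; apply: measurable_fun_ifT => //.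
  exact: measurable_fun_ler.
apply/measurable_EFinP; exact: measurableT_comp (@measurable_ln R) mg.
Qed.

Lemma past_measurable_llr n k m : (m <= n)%N ->
  measurable_fun (setT : set (past n)) (Z k m).
Proof.
move=> mn; rewrite /llr.
under eq_fun do rewrite big_nat big_mkcond /=.
apply: emeasurable_sum => j.
case: (boolP (k <= j < m)%N) => [/andP[kj jm]|_]; last exact: measurable_cst.
apply: measurable_lne_EFin; apply: past_measurable_likelihood_ratio.
by rewrite kj (leq_trans jm).
Qed.

Lemma measurable_llr k m : measurable_fun setT (Z k m).
Proof.
move=> _ B mB; apply: (sigma_history_measurable (n := m)).
have := past_measurable_llr k (leqnn m) measurableT mB.
by rewrite sigma_historyE.
Qed.

(** The convention [log 0 = -oo] makes the exponential a product of ratios even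
    where some of them vanish. *)
Lemma expeR_llr k n w :
  expeR (Z k n w) = (\prod_(k <= j < n)
    (f1 k (history X j w) (X j w) / f0 (history X j w) (X j w)))%:E.
Proof.
rewrite /llr -prodEFin (big_morph (@expeR R) (@expeRD R) (@expeR0 R)).
rewrite [LHS]big_nat [RHS]big_nat; apply: eq_bigr => j /andP[kj _].
by rewrite lneK // in_itv /= leey andbT lee_fin likelihood_ratio_ge0.
Qed.

Lemma past_measurable_expeR_llr n k m : (m <= n)%N ->
  measurable_fun (setT : set (past n)) (fun w => expeR (Z k m w)).
Proof.
move=> mn; under eq_fun do rewrite expeR_llr.
apply/measurable_EFinP; apply: measurable_prod => j.
rewrite mem_index_iota => /andP[kj jm]; apply: past_measurable_likelihood_ratio.
by rewrite kj (leq_trans jm).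
Qed.

(** * The Shiryaev-Roberts rule rarely stops early without a change *)

Definition stopped_by (tau : Omega -> option nat) (n : nat) : set Omega :=
  [set w | exists2 t, tau w = Some t & (t <= n)%N].

Lemma stopped_byS tau n :
  stopped_by tau n.+1 = stopped_by tau n `|` [set w | tau w = Some n.+1].
Proof.
apply/seteqP; split=> w /=.
  move=> [t tauE]; rewrite leq_eqVlt => /predU1P[<-|tn]; first by right.
  by left; exists t.
by case=> [[t tauE tn]|tauE]; [exists t => //; exact: leqW | exists n.+1].
Qed.

Lemma stopped_by0 tau : stopping_time X tau -> stopped_by tau 0 = set0.
Proof.
move=> [tau_neq0 _]; apply/seteqP; split=> w //= [t tauE].
by rewrite leqn0 => /eqP t0; case: (tau_neq0 w); rewrite tauE t0.
Qed.

Lemma stopping_time_eq tau n : stopping_time X tau ->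
  sigma_history X n.+1 [set w | tau w = Some n.+1].
Proof.
move=> [_ mtau].
rewrite (_ : [set _ | _] = stopped_by tau n.+1 `\` stopped_by tau n).
  have := sigma_history_le (leqnSn n) (mtau n); have := mtau n.+1.
  by rewrite !sigma_historyE => mSn mn; exact: measurableD.
rewrite stopped_byS; apply/seteqP; split=> w /=; last by case=> -[].
by move=> tauE; split; [right | case=> t; rewrite tauE => -[<-]; rewrite ltnn].
Qed.

Lemma first_timeP (Q : pred nat) n :
  (exists2 t, first_time Q = Some t & (t <= n)%N) <->
  (exists2 m, Q m & (m <= n)%N).
Proof.
rewrite /first_time; case: pselect => [exQ|noQ]; last first.
  by split=> [[]|[m Qm _]] //; case: noQ; exists m.
case: ex_minnP => t Qt tmin; split=> [[_ [<-] tn]|[m Qm mn]]; first by exists t.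
by exists t => //; exact: leq_trans (tmin _ Qm) mn.
Qed.

Lemma first_time_mem (Q : pred nat) n : first_time Q = Some n -> Q n.
Proof.
by rewrite /first_time; case: pselect => // exQ; case: ex_minnP => t Qt _ [<-].
Qed.

Local Notation SR := (sr_time X f0 f1).

Lemma sr_stopping_time h : stopping_time X (SR h).
Proof.
split=> [w /first_time_mem //|n].
rewrite (_ : [set _ | _] = \bigcup_(m in [set m | (1 <= m <= n)%N])
    [set w | (h%:E <= \sum_(0 <= k < m) expeR (Z k m w))%E]).
  rewrite sigma_historyE; apply: bigcup_measurable => m /andP[_ mn].
  rewrite -[X in measurable X]setTI; apply: measurable_lee => //.
  by apply: emeasurable_sum => k; exact: past_measurable_expeR_llr.
apply/seteqP; split=> w /=.
  by move=> /first_timeP[m /andP[m1 hm] mn]; exists m => //=; rewrite m1.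
by move=> [m /= /andP[m1 mn] hm]; apply/first_timeP; exists m; rewrite ?m1.
Qed.

(** On the event the statistic is at least [h], and each of its summands
    integrates under [P None] to a probability of the event, by the definition
    of the likelihood ratio. *)
Lemma sr_stop_le (h : R) n : 0 < h ->
  (h%:E * P None [set w | SR h w = Some n] <=
   \sum_(0 <= k < n) P (Some k) [set w | SR h w = Some n])%E.
Proof.
move=> h0; set D := [set _ | _].
case: n @D => [|n] D.
  rewrite (_ : D = set0) ?measure0 ?mule0 ?big_geq //.
  by apply/seteqP; split=> w // /first_time_mem.
have sD : sigma_history X n.+1 D.
  exact: stopping_time_eq (sr_stopping_time h).
have mD := sigma_history_measurable sD.
have mZ k : measurable_fun D (fun w => expeR (Z k n.+1 w)).
  move=> _ B mB; apply: (sigma_history_measurable (n := n.+1)).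
  have mZB := past_measurable_expeR_llr k (leqnn n.+1) measurableT mB.
  have mD' := sD; rewrite sigma_historyE in mD'.
  have := measurableI _ _ mD' mZB; rewrite setTI => mDZ.
  by rewrite sigma_historyE.
rewrite big_nat; under eq_bigr => k /andP[_ kn] do
  rewrite (model_likelihood_ratio model kn sD).
rewrite -big_nat -(ge0_integral_sum (P None) mD mZ) //; last first.
  by move=> k w _; exact: expeR_ge0.
rewrite -integral_cst //; apply: ge0_le_integral => //.
- by move=> w _; rewrite lee_fin ltW.
- exact: emeasurable_sum.
- by move=> w /first_time_mem /andP[].
Qed.

(** Summing [sr_stop_le] over the stopping times up to [n] bounds the left side
    by [\sum_(k < n) P_k (T <= n)].  The induction is on this sharper bound,
    whose terms absorb those of [sr_stop_le] at the new time. *)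
Lemma sr_false_alarm (h : R) n : 0 < h ->
  (h%:E * P None (stopped_by (SR h) n) <= n%:R%:E)%E.
Proof.
move=> h0; have stT := sr_stopping_time h.
have mB m : measurable (stopped_by (SR h) m).
  exact: sigma_history_measurable (stT.2 m).
apply: (@le_trans _ _ (\sum_(0 <= k < n) P (Some k) (stopped_by (SR h) n))%E).
  elim: n => [|n IHn]; first by rewrite stopped_by0 // measure0 mule0 big_geq.
  have mD : measurable [set w | SR h w = Some n.+1].
    exact: sigma_history_measurable (stopping_time_eq stT).
  have PS (Q : probability Omega R) : (Q (stopped_by (SR h) n.+1) =
      Q (stopped_by (SR h) n) + Q [set w | SR h w = Some n.+1])%E.
    rewrite stopped_byS measureU //.
    apply/seteqP; split=> w // -[[t /= -> tn] [tE]].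
    by rewrite tE ltnn in tn.
  rewrite PS ge0_muleDr //.
  apply: (@le_trans _ _ (\sum_(0 <= k < n.+1)
    (P (Some k) (stopped_by (SR h) n) +
     P (Some k) [set w | SR h w = Some n.+1]))%E).
    rewrite big_split /=; apply: leeD; last exact: sr_stop_le.
    by apply: le_trans IHn _; rewrite big_nat_recr //= leeDl.
  by apply: lee_sum => k _; rewrite -PS.
apply: (@le_trans _ _ (\sum_(0 <= k < n) 1)%E).
  by apply: lee_sum => k _; exact: probability_le1.
by rewrite sumEFin big_const_nat iter_addr addr0 subn0.
Qed.

(** * Delay bounds at a fixed time *)

(** On the part of [A] where [Z] is at most [c] the density of [P (Some k)] is
    at most [expR c]; the rest of [A] is inside the event that [Z] exceeds
    [c]. *)
Lemma change_of_measure k n c (A : set Omega) :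
  (k < n)%N -> sigma_history X n A ->
  (P (Some k) A <=
   (expR c)%:E * P None A + P (Some k) [set w | c%:E < Z k n w])%E.
Proof.
move=> kn sA; pose B := [set w | (Z k n w <= c%:E)%E].
have mZ := measurable_llr k n.
have mA := sigma_history_measurable sA.
have sAB : sigma_history X n (A `&` B).
  move: sA; rewrite sigma_historyE => sA; apply: measurableI => //.
  rewrite -[B]setTI; apply: measurable_lee => //; exact: past_measurable_llr.
have mAB := sigma_history_measurable sAB.
have mC : measurable [set w | (c%:E < Z k n w)%E].
  by rewrite -[X in measurable X]setTI; exact: measurable_lte.
apply: (@le_trans _ _
    (P (Some k) (A `&` B) + P (Some k) [set w | c%:E < Z k n w])%E).
  apply: le_trans (measureU2 _ mAB mC); apply: le_measure.
  - exact: mem_set.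
  - by apply: mem_set; exact: measurableU.
  - by move=> w Aw; have [Zc|cZ] := leP (Z k n w) c%:E; [left|right].
apply: leeD => //; rewrite (model_likelihood_ratio model kn sAB).
apply: (@le_trans _ _ ((expR c)%:E * P None (A `&` B))%E).
  rewrite -integral_cst //; apply: ge0_le_integral => //.
  - by move=> w _; exact: expeR_ge0.
  - apply: measurable_funS (measurableT) _ _ => //.
    move=> _ C mC'; apply: (sigma_history_measurable (n := n)).
    have := past_measurable_expeR_llr k (leqnn n) measurableT mC'.
    by rewrite sigma_historyE.
  - by move=> w [_]; rewrite /B /= -lee_expeR.
apply: lee_wpmul2l; first by rewrite lee_fin expR_ge0.
by apply: le_measure; [exact: mem_set..|exact: subIsetl].
Qed.

Lemma measurable_stopped_by tau n :
  stopping_time X tau -> measurable (stopped_by tau n).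
Proof. by move=> [_ mtau]; exact: sigma_history_measurable (mtau n). Qed.

Lemma measurable_delay nu tau : stopping_time X tau ->
  measurable_fun setT (fun w => delay nu (tau w) : \bar R).
Proof.
move=> st_tau _ B mB; rewrite setTI.
have mS n : measurable [set w | tau w = Some n].
  case: n => [|n]; last first.
    exact: sigma_history_measurable (stopping_time_eq st_tau).
  rewrite (_ : [set _ | _] = set0) //; apply/seteqP; split=> w //.
  by move/(st_tau.1 w).
have mN : measurable [set w | tau w = None].
  rewrite (_ : [set _ | _] = ~` \bigcup_n [set w | tau w = Some n]).
    by apply: measurableC; exact: bigcup_measurable.
  apply/seteqP; split=> w /=; first by move=> tauN [n _ /=]; rewrite tauN.
  by case tauE: (tau w) => [n|] // []; exists n.
rewrite (_ : _ @^-1` B = \bigcup_(n in [set n | B (delay nu (Some n))])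
   [set w | tau w = Some n] `|` [set w | tau w = None /\ B (delay nu None)]).
  apply: measurableU; first exact: bigcup_measurable.
  have [BN|BN] := pselect (B (delay nu None)).
    by rewrite (_ : [set _ | _] = [set w | tau w = None]) //;
       apply/seteqP; split=> w //= -[].
  by rewrite (_ : [set _ | _] = set0) //; apply/seteqP; split=> w //= -[].
apply/seteqP; split=> w /=.
  by case tauE: (tau w) => [n|] Bn; [left; exists n | right].
by case=> [[n /= Bn ->]|[-> ]].
Qed.

Lemma delay_ge0 nu t : (0 <= delay nu t :> \bar R)%E.
Proof. by case: t => [n|] /=; rewrite ?leey // lee_fin ler0n. Qed.

Lemma risk_ge nu tau n : stopping_time X tau ->
  (n.+1%:R%:E * (1 - P (Some nu) (stopped_by tau (nu + n))) <= risk P nu tau)%E.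
Proof.
move=> st_tau; have mB := measurable_stopped_by (nu + n) st_tau.
rewrite -probability_setC // -integral_cst; last exact: measurableC.
have mdelay := measurable_delay nu st_tau.
apply: (@le_trans _ _
   (\int[P (Some nu)]_(w in ~` stopped_by tau (nu + n)) delay nu (tau w))%E).
  apply: ge0_le_integral => //.
  - exact: measurableC.
  - by move=> w _; rewrite lee_fin.
  - exact: measurable_funS mdelay.
  - move=> w nB; case tauE: (tau w) => [t|] /=; last by rewrite leey.
    rewrite lee_fin ler_nat ltn_subRL ltnNge; apply/negP => tn.
    by apply: nB; exists t.
apply: ge0_subset_integral => //; first exact: measurableC.
by move=> w _; exact: delay_ge0.
Qed.

Definition deviates (I eps : R) nu n : set Omega :=
  [set w | (eps%:E < `| (n%:R^-1)%:E * Z nu (nu + n) w - I%:E |)%E].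

Definition deviation (I eps : R) n : \bar R :=
  ereal_sup (range (fun k => P (Some k) (deviates I eps k n))).

Lemma measurable_deviates I eps nu n : measurable (deviates I eps nu n).
Proof.
rewrite -[deviates _ _ _ _]setTI; apply: measurable_lte => //.
apply: measurableT_comp => //; apply: emeasurable_funB => //.
by apply: measurable_funeM; exact: measurable_llr.
Qed.

Lemma le_deviation I eps nu n :
  (P (Some nu) (deviates I eps nu n) <= deviation I eps n)%E.
Proof. by apply: ereal_sup_ubound; exists nu. Qed.

Lemma deviation_ge0 I eps n : (0 <= deviation I eps n)%E.
Proof. exact: le_trans (measure_ge0 _ _) (le_deviation I eps 0 n). Qed.

(** Before stopping, the statistic is below [h], and so is its summand
    [expeR (Z nu (nu + n))]. *)
Lemma not_sr_stopped (h : R) nu n w : 0 < h -> (0 < n)%N ->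
  ~ stopped_by (SR h) (nu + n) w -> (Z nu (nu + n) w < (ln h)%:E)%E.
Proof.
move=> h0 n0 notT; rewrite -lte_expeR /= lnK ?posrE // ltNge; apply/negP => hZ.
apply: notT; apply/first_timeP; exists (nu + n)%N => //.
rewrite addn_gt0 n0 orbT /= (le_trans hZ) //.
rewrite (bigD1_seq nu) ?iota_uniq //=; last first.
  by rewrite mem_index_iota /= -addn1 leq_add2l.
by rewrite leeDl // sume_ge0 // => k _; exact: expeR_ge0.
Qed.

Lemma deviates_below (I eps c : R) nu n w : 0 < eps -> (0 < n)%N ->
  c <= (I - eps) * n%:R -> (Z nu (nu + n) w < c%:E)%E ->
  deviates I eps nu n w.
Proof.
move=> eps0 n0 cn Zc; rewrite /deviates /=.
have n0R : 0 < n%:R :> R by rewrite ltr0n.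
case: (Z nu (nu + n) w) Zc => [z||] //=.
- rewrite lte_fin => zc; rewrite lte_fin.
  apply: (@lt_le_trans _ _ (I - n%:R^-1 * z)); last by rewrite distrC ler_norm.
  rewrite ltrBrDl -ltrBrDr mulrC ltr_pdivrMr //.
  exact: lt_le_trans zc cn.
- by move=> _; rewrite gt0_muleNy ?lte_fin ?invr_gt0 //= ltry.
Qed.

(** If the delay exceeds [N.+1], then every [n] from [N.+1] up to the delay is a
    time at which the rule has not stopped, hence a time of deviation.  So the
    delay is at most [N.+1] plus the number of deviations, and integrating this
    count gives the series. *)
Lemma sr_risk_le (h I eps : R) nu N : 0 < h -> 0 < eps ->
  (0 < I - eps) -> ln h <= (I - eps) * N.+1%:R ->
  (risk P nu (SR h) <= N.+1%:R%:E +
   \sum_(1 <= n <oo) deviation I eps n)%E.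
Proof.
move=> h0 eps0 Ieps0 lnhN.
(* Emptied at n = 0, so that the series of indicators can start from 0. *)
pose D n := if (0 < n)%N then deviates I eps nu n else set0.
have mD n : measurable (D n).
  by rewrite /D; case: ifP => // _; exact: measurable_deviates.
apply: (@le_trans _ _
    (N.+1%:R%:E + \sum_(n <oo) P (Some nu) (D n))%E); last first.
  apply: leeD => //; rewrite [leRHS]eseries_cond [leRHS]eseries_mkcond.
  apply: lee_nneseries => // n _; rewrite /D.
  by case: ifP => n0; rewrite ?measure0 ?le_deviation.
have D0 w n : (0 <= (\1_(D n) w : R)%:E)%E by rewrite lee_fin.
have mI n : measurable_fun setT (fun w => (\1_(D n) w : R)%:E).
  by apply/measurable_EFinP; exact: measurable_indic.
under eq_eseriesr => n _ do rewrite -[D n]setIT -integral_indic //.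
rewrite -integral_nneseries //.
rewrite -[X in (X + _)%E](_ : \int[P (Some nu)]_w N.+1%:R%:E = _)%E; last first.
  by rewrite integral_cst //= probability_setT mule1.
rewrite -ge0_integralD //; last 2 first.
- by move=> w _; apply: nneseries_ge0 => n _ _; exact: D0.
- exact: ge0_emeasurable_sum.
apply: ge0_le_integral => //.
- by move=> w _; exact: delay_ge0.
- exact: measurable_delay (sr_stopping_time h).
- apply: emeasurable_funD => //; exact: ge0_emeasurable_sum.
move=> w _ /=; set S := (\sum_(n <oo) _)%E.
have S0 : (0 <= S)%E by apply: nneseries_ge0 => n _ _; exact: D0.
have count M : (forall n, (n < M)%N -> ~ stopped_by (SR h) (nu + n) w) ->
    (M%:R%:E <= N.+1%:R%:E + S)%E.
  move=> run; have [MN|NM] := leqP M N.+1.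
    by apply: (@le_trans _ _ N.+1%:R%:E); rewrite ?leeDl // lee_fin ler_nat.
  rewrite -(subnKC (ltnW NM)) natrD EFinD leeD2lE //.
  apply: (@le_trans _ _ (\sum_(0 <= n < M) (\1_(D n) w : R)%:E)%E); last first.
    exact: nneseries_lim_ge.
  rewrite (big_cat_nat (n := N.+1)) //=; last exact: ltnW.
  apply: (@le_trans _ _ (\sum_(N.+1 <= n < M) (\1_(D n) w : R)%:E)%E);
    last by rewrite leeDr // sume_ge0.
  rewrite [X in (_ <= X)%E]big_nat (eq_bigr (fun=> 1%E)).
    by rewrite -big_nat sumEFin big_const_nat iter_addr addr0.
  move=> n /andP[Nn nM]; rewrite indicE mem_set // /D (leq_trans _ Nn) //.
  apply: (@deviates_below _ _ (ln h)) => //; first exact: leq_trans Nn.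
    by rewrite (le_trans lnhN) // ler_pM2l // ler_nat.
  by apply: not_sr_stopped (run _ nM) => //; exact: leq_trans Nn.
case TE: (SR h w) => [t|] /=.
  apply: count => n; rewrite ltn_subRL => nt [t']; rewrite TE => -[<-].
  by rewrite leqNgt nt.
have countT M : (M%:R%:E <= N.+1%:R%:E + S)%E.
  by apply: count => n _ [t']; rewrite TE.
rewrite leye_eq; apply/eqP/eqyP => r r0.
apply: le_trans (countT (Num.truncn r).+1).
by rewrite lee_fin ltW // truncnS_gt.
Qed.

(** All the windows of the class end before [kstar], so a rule that stops in
    one of them has stopped by [kstar.-1]. *)
Lemma sr_false_alarm_class beta (kstar mstar : nat) h : 0 < h ->
  kstar.-1%:R <= beta * h ->
  false_alarm_class P X beta kstar mstar (SR h).
Proof.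
move=> h0 kh; split; first exact: sr_stopping_time h.
apply: ge_ereal_sup => _ [k /= /andP[k1 kkm] <-].
have st := sr_stopping_time h.
have mB := measurable_stopped_by kstar.-1 st.
apply: (@le_trans _ _ (P None (stopped_by (SR h) kstar.-1))).
  apply: le_measure; last first.
  - move=> w [t tE /andP[_ tk]]; exists t => //.
    have k0 : (0 < kstar - mstar)%N by exact: leq_trans kkm.
    rewrite subn_gt0 in k0; rewrite -ltnS prednK; last exact: leq_ltn_trans k0.
    by apply: leq_trans tk _; rewrite -(subnK (ltnW k0)) leq_add2r.
  - exact: mem_set.
  - apply: mem_set.
    rewrite (_ : [set _ | _] = \bigcup_(t in [set t | (k <= t < k + mstar)%N])
        [set w | SR h w = Some t]).
      apply: bigcup_measurable => t /andP[kt _].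
      have t0 : (0 < t)%N by exact: leq_trans kt.
      rewrite -(prednK t0).
      exact: sigma_history_measurable (stopping_time_eq st).
    by apply/seteqP; split=> w [t]; exists t.
rewrite -(@lee_pmul2l _ h%:E) ?lte_fin //.
apply: le_trans (sr_false_alarm _ h0) _.
by rewrite -EFinM lee_fin mulrC.
Qed.

(** The first window, starting at time 1, contains all the times up to
    [nu + n]. *)
Lemma false_alarm_class_stopped_by (beta : R) (ks ms : nat) tau nu n :
  (ms < ks)%N -> false_alarm_class P X beta ks ms tau -> (nu + n <= ms)%N ->
  (P None (stopped_by tau (nu + n)) <= beta%:E)%E.
Proof.
move=> mk [st_tau tau_le] nm.
have tau_gt0 w t : tau w = Some t -> (0 < t)%N.
  by case: t => // tau0; case: (st_tau.1 w).
apply: le_trans tau_le; apply: le_trans (ereal_sup_ubound _); last first.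
  by exists 1%N => //=; rewrite subn_gt0.
apply: le_measure.
- by apply: mem_set; exact: measurable_stopped_by st_tau.
- apply: mem_set.
  rewrite (_ : [set _ | _] = stopped_by tau ms).
    exact: measurable_stopped_by st_tau.
  apply/seteqP; split=> w [t tauE tm]; exists t => //; first by lia.
  by have := tau_gt0 _ _ tauE; lia.
by move=> w [t tauE tn]; exists t => //; have := tau_gt0 _ _ tauE; lia.
Qed.

Lemma false_alarm_class_stop_le (beta I eps : R) (ks ms : nat) tau nu n :
  (0 < n)%N -> (ms < ks)%N -> false_alarm_class P X beta ks ms tau ->
  (nu + n <= ms)%N ->
  (P (Some nu) (stopped_by tau (nu + n)) <=
   (expR ((I + eps) * n%:R) * beta)%:E + deviation I eps n)%E.
Proof.
move=> n0 mk Htau nm; have n0R : 0 < n%:R :> R by rewrite ltr0n.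
have [st_tau _] := Htau.
have nun : (nu < nu + n)%N by rewrite -addn1 leq_add2l.
apply: le_trans (change_of_measure ((I + eps) * n%:R) nun (st_tau.2 _)) _.
apply: leeD.
  rewrite EFinM lee_wpmul2l ?lee_fin ?expR_ge0 //.
  exact: false_alarm_class_stopped_by mk Htau nm.
apply: le_trans (le_deviation _ _ nu _); apply: le_measure.
- apply: mem_set; rewrite -[X in measurable X]setTI.
  by apply: measurable_lte => //; exact: measurable_llr.
- by apply: mem_set; exact: measurable_deviates.
move=> w; rewrite /deviates /=; case: (Z nu (nu + n) w) => [z||] //=.
- rewrite !lte_fin => zc; apply: lt_le_trans (ler_norm _).
  by rewrite ltrBrDr mulrC ltr_pdivlMr // addrC.
- by move=> _; rewrite gt0_muley ?lte_fin ?invr_gt0 //= ltry.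
Qed.

(** The terms of a convergent series of nonnegative numbers are bounded by its
    tails. *)
Lemma deviation_cvg0 (I eps e : R) : uniform_complete_convergence P X f0 f1 I ->
  0 < eps -> 0 < e ->
  \forall n \near \oo, (deviation I eps n <= e%:E)%E.
Proof.
move=> ucc eps0 e0; have := ucc _ eps0; rewrite -/(deviation I eps) => fin.
have := @nneseries_tail_cvg R (deviation I eps) (fun n => (1 <= n)%N).
have -> : (\sum_(0 <= k <oo | (1 <= k)%N) deviation I eps k =
           \sum_(1 <= k <oo) deviation I eps k)%E.
  by rewrite [RHS]eseries_cond.
move=> /(_ fin (fun n _ => deviation_ge0 I eps n))
  /fine_cvgP[finT /cvgrPdist_le/(_ _ e0) cvT].
pose S N := (\sum_(N <= k <oo | (1 <= k)%N) deviation I eps k)%E.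
near=> n.
have n1 : (1 <= n)%N by near: n; exact: nbhs_infty_ge.
have Sfin : S n \is a fin_num by near: n; exact: finT.
have Se : `|0 - fine (S n)| <= e by near: n; exact: cvT.
apply: (@le_trans _ _ (S n)).
  apply: le_trans (nneseries_lim_ge n.+1 _); last first.
    by move=> *; exact: deviation_ge0.
  by rewrite big_mkcond big_nat1 n1.
rewrite -(fineK Sfin) lee_fin (le_trans _ Se) // sub0r normrN ler_norm.
Unshelve. all: by end_near. Qed.

(** * First-order bounds for the risks *)

Context (mstar kstar : R -> nat).
Context (mkstar : forall beta : R, 0 < beta < 1 ->
  (1 <= mstar beta)%N /\ (mstar beta < kstar beta)%N).

Lemma threshold_false_alarm_class beta : 0 < beta < 1 ->
  false_alarm_class P X beta (kstar beta) (mstar beta)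
    (SR (threshold kstar beta)).
Proof.
move=> b01; apply: sr_false_alarm_class.
  exact: threshold_gt0.
apply: threshold_false_alarm => //.
by have [_] := mkstar b01; exact: leq_ltn_trans.
Qed.

Context (lim_alpha1 :
  `|ln (alpha1 mstar beta)| / `|ln beta| @[beta --> 0^'+] --> (1 : R)).
Context (lim_alpha2 :
  `|ln (alpha2 kstar beta)| / `|ln beta| @[beta --> 0^'+] --> (1 : R)).
Context (I : R) (I0 : 0 < I).
Context (ucc : uniform_complete_convergence P X f0 f1 I).

(** The parameter [d] satisfies [(1 - d) * (1 - 2 * d) >= 1 - eps]: one factor
    comes from the time [n], the other from the probability, at most [2 * d],
    of stopping by [nu + n]. *)
Lemma near_class_risk_ge nu (eps : R) : 0 < eps ->
  \forall beta \near 0^'+, forall tau,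
    false_alarm_class P X beta (kstar beta) (mstar beta) tau ->
    (((1 - eps) * (`|ln beta| / I))%:E <= risk P nu tau)%E.
Proof.
move=> eps0; pose d : R := Num.min 2^-1 (eps / 3).
have d0 : 0 < d by rewrite lt_min; apply/andP; split; lra.
have dh : d <= 2^-1 by rewrite /d ge_min lexx.
have de : 3 * d <= eps.
  have : d <= eps / 3 by rewrite /d ge_min lexx orbT.
  by lra.
have Id0 : 0 < I * d by exact: mulr_gt0.
have [N _ devN] := deviation_cvg0 ucc Id0 d0.
near=> beta => tau Htau; have [st_tau _] := Htau.
have b01 : 0 < beta < 1 by near: beta; exact: near_lt1.
have [_ mk] := mkstar b01; have /andP[b0 _] := b01.
have x0 := norm_ln_gt0 b01.
have betaE : beta = expR (- `|ln beta|) by rewrite norm_ln // opprK lnK.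
have x1 : 1 <= `|ln beta| by near: beta; exact: near_norm_ln_ge.
have xN : (N.+1%:R) * (I / (1 - d)) <= `|ln beta|.
  by near: beta; exact: near_norm_ln_ge.
have xd : - ln d / d ^+ 2 <= `|ln beta| by near: beta; exact: near_norm_ln_ge.
have xm : (nu%:R + I^-1) * `|ln beta| <= (mstar beta)%:R.
  by near: beta; exact: near_mstar_ge.
set x := `|ln beta| in x0 betaE x1 xN xd xm *.
pose y := (1 - d) * (x / I).
have xI0 : 0 < x / I by exact: divr_gt0.
have y0 : 0 <= y by rewrite mulr_ge0 ?ltW // subr_gt0; lra.
pose n := Num.truncn y.
have ny : n%:R <= y by rewrite truncn_le.
have yn : y < n.+1%:R by exact: truncnS_gt.
have Nn : (N < n)%N.
  rewrite truncn_gt_nat.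
  move: xN; rewrite /y mulrA ler_pdivrMr; last by lra.
  by rewrite mulrA ler_pdivlMr // [x * _]mulrC.
have n0 : (0 < n)%N by exact: leq_ltn_trans Nn.
have nm : (nu + n <= mstar beta)%N.
  rewrite -(ler_nat R) natrD; apply: le_trans xm.
  have : nu%:R <= nu%:R * x by rewrite ler_peMr.
  have : y <= x / I by rewrite ler_piMl ?ltW //; lra.
  by rewrite mulrDl [I^-1 * x]mulrC; lra.
(* (1 + d) * I * y = (1 - d ^+ 2) * x, so the product is at most
   expR (- d ^+ 2 * x). *)
have small : expR ((I + I * d) * n%:R) * beta <= d.
  rewrite [X in _ * X <= _]betaE -expRD -[leRHS]lnK ?posrE // ler_expR.
  have : (I + I * d) * n%:R <= (I + I * d) * y by rewrite ler_pM2l // addr_gt0.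
  have -> : (I + I * d) * y = (1 - d ^+ 2) * x.
    by rewrite /y; field; rewrite gt_eqF.
  by move: xd; rewrite ler_pdivrMr ?exprn_gt0 // => xd; lra.
have stop := false_alarm_class_stop_le I (I * d) n0 mk Htau nm.
have {}stop : (P (Some nu) (stopped_by tau (nu + n))
    <= (d + d)%:E)%E.
  apply: le_trans stop _; rewrite EFinD leeD // ?lee_fin //.
  by apply: devN => /=; exact: ltnW.
apply: le_trans (risk_ge nu n st_tau).
apply: (@le_trans _ _ (n.+1%:R%:E * (1 - (d + d))%:E)%E).
  rewrite -EFinM lee_fin; apply: (@le_trans _ _ (y * (1 - (d + d)))).
    rewrite /y mulrAC ler_pM2r //; nra.
  by rewrite ler_wpM2r ?(ltW yn) //; lra.
by rewrite lee_wpmul2l ?lee_fin // EFinB leeB.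
Unshelve. all: by end_near. Qed.

(** The parameter [d] satisfies [(1 + d) / (1 - d) <= 1 + eps / 2]; the other
    half of [eps] pays for the series of deviations and the rounding of [N]. *)
Lemma near_sr_risk_le (eps : R) : 0 < eps ->
  \forall beta \near 0^'+, forall nu,
    (risk P nu (SR (threshold kstar beta)) <=
     ((1 + eps) * (`|ln beta| / I))%:E)%E.
Proof.
move=> eps0; pose d : R := Num.min 2^-1 (eps / 8).
have d0 : 0 < d by rewrite lt_min; apply/andP; split; lra.
have dh : d <= 2^-1 by rewrite /d ge_min lexx.
have de : 8 * d <= eps.
  have : d <= eps / 8 by rewrite /d ge_min lexx orbT.
  by lra.
have Id0 : 0 < I * d by exact: mulr_gt0.
have Id1 : 0 < I - I * d by nra.
have := ucc Id0; rewrite -/(deviation I (I * d)).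
set S := (\sum_(1 <= n <oo) deviation I (I * d) n)%E => Soo.
have S0 : (0 <= S)%E by apply: nneseries_ge0 => n _ _; exact: deviation_ge0.
have Sfin : S \is a fin_num by rewrite ge0_fin_numE.
near=> beta => nu.
have b01 : 0 < beta < 1 by near: beta; exact: near_lt1.
have x0 := norm_ln_gt0 b01.
have lnh : ln (threshold kstar beta) <= (1 + d) * `|ln beta|.
  by near: beta; exact: near_ln_threshold_le.
have xS : (1 + fine S) * (2 * I / eps) <= `|ln beta|.
  by near: beta; exact: near_norm_ln_ge.
set x := `|ln beta| in x0 lnh xS *.
pose y := (1 + d) * x / (I - I * d).
have y0 : 0 <= y by rewrite divr_ge0 ?ltW // mulr_gt0 // addr_gt0.
pose N := Num.truncn y.
have Ny : N%:R <= y by rewrite truncn_le.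
have yN : y < N.+1%:R by exact: truncnS_gt.
have lnhN : ln (threshold kstar beta) <= (I - I * d) * N.+1%:R.
  by apply: le_trans lnh _; rewrite [leRHS]mulrC -ler_pdivrMr // ltW.
apply: le_trans (sr_risk_le nu (threshold_gt0 kstar b01) Id0 Id1 lnhN) _.
rewrite -/S -(fineK Sfin) -EFinD lee_fin.
have yx : y <= (1 + eps / 2) * (x / I).
  rewrite /y ler_pdivrMr //.
  have -> : (1 + eps / 2) * (x / I) * (I - I * d) = (1 + eps / 2) * (1 - d) * x.
    by field; rewrite gt_eqF.
  by rewrite ler_pM2r //; nra.
have : 1 + fine S <= eps / 2 * (x / I).
  rewrite mulrA ler_pdivlMr // mulrAC ler_pdivlMr //.
  by move: xS; rewrite mulrA ler_pdivrMr //; lra.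
by rewrite -[N.+1%:R]natr1; lra.
Unshelve. all: by end_near. Qed.

End change_point.

Lemma near_log_ratio_gt0 (R : realType) (I : R) : 0 < I ->
  \forall beta \near (0 : R)^'+, 0 < `|ln beta| / I.
Proof.
move=> I0; near=> beta; apply: divr_gt0 => //; apply: norm_ln_gt0.
by near: beta; exact: near_lt1.
Unshelve. all: by end_near. Qed.

Theorem theorem6 (R : realType) (dO dE : measure_display)
  (Omega : measurableType dO) (E : measurableType dE)
  (mu : {sigma_finite_measure set E -> \bar R})
  (P : option nat -> probability Omega R)
  (X : nat -> {mfun Omega >-> E})
  (f0 : forall j : nat, j.-tuple E -> E -> R)
  (f1 : nat -> forall j : nat, j.-tuple E -> E -> R)
  (model : change_point_model mu P X f0 f1)
  (mstar kstar : R -> nat)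
  (mkstar : forall beta : R, 0 < beta < 1 ->
     (1 <= mstar beta)%N /\ (mstar beta < kstar beta)%N)
  (lim_alpha1 :
     `|ln (alpha1 mstar beta)| / `|ln beta| @[beta --> 0^'+] --> (1 : R))
  (lim_alpha2 :
     `|ln (alpha2 kstar beta)| / `|ln beta| @[beta --> 0^'+] --> (1 : R)) :
  let T beta := sr_time X f0 f1 (threshold kstar beta) in
  let H beta := false_alarm_class P X beta (kstar beta) (mstar beta) in
  let inf_risk nu beta := ereal_inf [set risk P nu tau | tau in H beta] in
  let inf_sup_risk beta := ereal_inf [set sup_risk P tau | tau in H beta] in
  (forall beta : R, 0 < beta < 1 -> H beta (T beta)) /\
  (forall I : R, 0 < I ->
     uniform_complete_convergence P X f0 f1 I ->
     [/\ forall nu : nat,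
           (inf_risk nu beta / risk P nu (T beta))%E
             @[beta --> 0^'+] --> 1%E,
         (inf_sup_risk beta / sup_risk P (T beta))%E
           @[beta --> 0^'+] --> 1%E,
         forall nu : nat,
           asymp_equiv (fun beta => risk P nu (T beta)) (inf_risk nu) /\
           asymp_equiv (inf_risk nu) (fun beta => (`|ln beta| / I)%:E) &
         asymp_equiv (fun beta => sup_risk P (T beta)) inf_sup_risk /\
         asymp_equiv inf_sup_risk (fun beta => (`|ln beta| / I)%:E)]).
Proof.
move=> T H inf_risk inf_sup_risk.
have HT beta : 0 < beta < 1 -> H beta (T beta).
  exact: (threshold_false_alarm_class model mkstar).
split=> // I I0 ucc; pose l beta := `|ln beta| / I.
have l0 : \forall beta \near 0^'+, 0 < l beta by exact: near_log_ratio_gt0.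
have upper eps : 0 < eps -> \forall beta \near 0^'+,
    H beta (T beta) /\
    forall nu, (risk P nu (T beta) <= ((1 + eps) * l beta)%:E)%E.
  move=> eps0; have := near_sr_risk_le model lim_alpha2 I0 ucc eps0.
  by apply: filterS2 near_lt1 => beta b01; split; [exact: HT|].
have lower nu eps : 0 < eps -> \forall beta \near 0^'+,
    forall tau, H beta tau ->
    (((1 - eps) * l beta)%:E <= risk P nu tau)%E.
  exact: (near_class_risk_ge model mkstar lim_alpha1 I0 ucc nu).
(* Hence lower bounds for the risk at nu = 0 are bounds for sup_risk. *)
have risk_sup nu tau : (risk P nu tau <= sup_risk P tau)%E.
  by apply: ereal_sup_ubound; exists nu.
have risk_l nu : squeezed (fun beta => risk P nu (T beta)) l.
  move=> eps eps0; apply: filterS2 (upper _ eps0) (lower nu _ eps0).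
  by move=> beta [HTb up] lo; rewrite up lo.
have inf_risk_l nu : squeezed (inf_risk nu) l.
  move=> eps eps0; apply: filterS2 (upper _ eps0) (lower nu _ eps0).
  move=> beta [HTb up] lo; apply/andP; split.
    by apply: le_ereal_inf_tmp => _ [tau Htau <-]; exact: lo.
  by apply: le_trans (up nu); apply: ereal_inf_lbound; exists (T beta).
have sup_risk_l : squeezed (fun beta => sup_risk P (T beta)) l.
  move=> eps eps0; apply: filterS2 (upper _ eps0) (lower 0%N _ eps0).
  move=> beta [HTb up] lo; rewrite (le_trans (lo _ HTb)) //=.
  by apply: ge_ereal_sup => _ [nu _ <-]; exact: up.
have inf_sup_risk_l : squeezed inf_sup_risk l.
  move=> eps eps0; apply: filterS2 (upper _ eps0) (lower 0%N _ eps0).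
  move=> beta [HTb up] lo; apply/andP; split.
    apply: le_ereal_inf_tmp => _ [tau Htau <-].
    by rewrite (le_trans (lo _ Htau)).
  apply: (@le_trans _ _ (sup_risk P (T beta))).
    by apply: ereal_inf_lbound; exists (T beta).
  by apply: ge_ereal_sup => _ [nu _ <-]; exact: up.
have ll := squeezed_refl l0.
split=> [nu||nu|]; [|exact: (squeezed_asymp_equiv l0)|split|split].
all: by apply: (squeezed_asymp_equiv l0).
Qed.
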